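(* Let $V$ be a quasi-regular mixed lattice vector space and $A$ a mixed lattice subspace of $V$. Then the right disjoint complement of $A$ satisfies $$A^{\perp}=\{x\in V: s(z)\curlywedge s(x)=0 \text{ for all } z\in A\}.$$
   Context: A mixed lattice vector space is a real vector space $V$ with two partial orderings $\le$ (initial) and $\preceq$ (specific), each compatible with the vector space structure, such that for all $x,y$ the mixed lower envelope $x\curlywedge y=\max\{w: w\preceq x,\ w\le y\}$ and mixed upper envelope $x\curlyvee y=\min\{w: x\preceq w,\ y\le w\}$ exist (max/min with respect to $\le$). $V_{sp}=\{x:0\preceq x\}$, $A_{sp}=A\cap V_{sp}$. $V$ is quasi-regular if $V_{sp}$ is closed under $\curlywedge,\curlyvee$. A mixed lattice subspace is a linear subspace closed under $\curlywedge,\curlyvee$; an ideal is a $(\le)$-order convex mixed lattice subspace. The right disjoint complement $A^{\perp}$ is the smallest ideal of $V$ containing $\{x\in V_{sp}: z\curlywedge x=0 \text{ for all } z\in A_{sp}\}$. The symmetric generalized absolute value is $s(x)=\tfrac12\big((x\curlyvee 0)+(0\curlyvee(-x))+((-x)\curlyvee 0)+(0\curlyvee x)\big)$. *)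

(* Defs.v *)
From HB Require Import structures.
From mathcomp Require Import all_boot all_order all_algebra.
From mathcomp Require Import reals.
Set Implicit Arguments. Unset Strict Implicit. Unset Printing Implicit Defensive.
Import Order.TTheory GRing.Theory Num.Theory.
Local Open Scope ring_scope.

(* A mixed lattice vector space structure on V: two partial orders
   le (initial, <=) and sle (specific, ⪯), compatible with the vector space
   structure, together with the mixed lower / upper envelopes, characterized
   as the (<=)-max of {w | w ⪯ x, w <= y} and the (<=)-min of {w | x ⪯ w, y <= w}. *)
Record mixed_lattice (R : realType) (V : lmodType R) := MixedLattice {
  mle : V -> V -> Prop;
  msle : V -> V -> Prop;
  mlow : V -> V -> V;
  mup : V -> V -> V;
  mle_refl : forall x, mle x x;
  mle_anti : forall x y, mle x y -> mle y x -> x = y;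
  mle_trans : forall x y z, mle x y -> mle y z -> mle x z;
  mle_add : forall x y z, mle x y -> mle (x + z) (y + z);
  mle_scale : forall (a : R) x, 0 <= a -> mle 0 x -> mle 0 (a *: x);
  msle_refl : forall x, msle x x;
  msle_anti : forall x y, msle x y -> msle y x -> x = y;
  msle_trans : forall x y z, msle x y -> msle y z -> msle x z;
  msle_add : forall x y z, msle x y -> msle (x + z) (y + z);
  msle_scale : forall (a : R) x, 0 <= a -> msle 0 x -> msle 0 (a *: x);
  mlow_sle : forall x y, msle (mlow x y) x;
  mlow_le : forall x y, mle (mlow x y) y;
  mlow_max : forall x y w, msle w x -> mle w y -> mle w (mlow x y);
  mup_sle : forall x y, msle x (mup x y);
  mup_le : forall x y, mle y (mup x y);
  mup_min : forall x y w, msle x w -> mle y w -> mle (mup x y) w;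
}.

Section Defs.
Variables (R : realType) (V : lmodType R) (M : mixed_lattice V).

Definition Vsp (x : V) : Prop := msle M 0 x.

Definition quasi_regular : Prop :=
  forall x y, Vsp x -> Vsp y -> Vsp (mlow M x y) /\ Vsp (mup M x y).

Definition linear_subspace (A : V -> Prop) : Prop :=
  [/\ A 0,
      forall x y, A x -> A y -> A (x + y)
    & forall (a : R) x, A x -> A (a *: x)].

Definition mixed_lattice_subspace (A : V -> Prop) : Prop :=
  [/\ linear_subspace A,
      forall x y, A x -> A y -> A (mlow M x y)
    & forall x y, A x -> A y -> A (mup M x y)].

Definition order_convex (A : V -> Prop) : Prop :=
  forall x y z, A x -> A z -> mle M x y -> mle M y z -> A y.

Definition ideal (A : V -> Prop) : Prop :=
  mixed_lattice_subspace A /\ order_convex A.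

Definition rdisj_gen (A : V -> Prop) (x : V) : Prop :=
  Vsp x /\ forall z, A z -> Vsp z -> mlow M z x = 0.

(* A^⊥ : the smallest ideal containing rdisj_gen A, i.e. the intersection
   of all ideals containing it. *)
Definition right_disjoint_complement (A : V -> Prop) (x : V) : Prop :=
  forall I, ideal I -> (forall y, rdisj_gen A y -> I y) -> I x.

Definition sabs (x : V) : V :=
  (2%:R)^-1 *: (mup M x 0 + mup M 0 (- x) + mup M (- x) 0 + mup M 0 x).

End Defs.

(* Main.v *)
Require Import Defs.
From HB Require Import structures.
From mathcomp Require Import all_boot all_order all_algebra.
From mathcomp Require Import reals.
Import Order.TTheory GRing.Theory Num.Theory.
Local Open Scope ring_scope.

(* By translation invariance, s(x) = (0 ⋎ x) + (0 ⋎ -x), so s(x) is specifically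
   positive, s fixes V_sp, -s(x) <= x <= s(x), and s is subadditive.  As s maps A
   onto A_sp, the right-hand set is D = {x | s(x) in G}, where G is the generating
   set of A^⊥.  Every ideal containing G contains D because -s(x) <= x <= s(x).
   Conversely G is a cone, solid within V_sp, so D is an order convex subspace; it
   is closed under the envelopes because 0 <= x ⋎ 0 <= s(x). *)

(** * Translation-invariant relations, to be used for both [mle] and [msle] *)

Section CompatibleOrder.
Context {R : realType} {V : lmodType R} {le : V -> V -> Prop}.
Hypothesis le_add : forall x y z, le x y -> le (x + z) (y + z).

Lemma compat_sub_ge0 x y : le 0 (y - x) <-> le x y.
Proof.
split=> h; first by have := le_add _ _ x h; rewrite add0r subrK.
by have := le_add _ _ (- x) h; rewrite subrr.
Qed.

Lemma compat_opp x y : le x y -> le (- y) (- x).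
Proof. by move=> /compat_sub_ge0 h; apply/compat_sub_ge0; rewrite opprK addrC. Qed.

Lemma compat_scale (a : R) x y :
  (forall (b : R) v, 0 <= b -> le 0 v -> le 0 (b *: v)) ->
  0 <= a -> le x y -> le (a *: x) (a *: y).
Proof.
move=> hsc a0 /compat_sub_ge0 h; apply/compat_sub_ge0.
by rewrite -scalerBr; apply: hsc.
Qed.

Lemma compat_addl x y z : le x y -> le (z + x) (z + y).
Proof. by rewrite ![z + _]addrC; apply: le_add. Qed.

Lemma compat_addDr x y : le 0 y -> le x (x + y).
Proof. by move=> /(compat_addl _ _ x); rewrite addr0. Qed.

Lemma compat_addD x y z t :
  (forall u v w, le u v -> le v w -> le u w) ->
  le x y -> le z t -> le (x + z) (y + t).
Proof.
by move=> tr h1 h2; apply: tr (le_add _ _ z h1) (compat_addl _ _ y h2).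
Qed.

End CompatibleOrder.

Section MixedLattice.
Arguments mle_add {R V} m x y z _.
Arguments mle_scale {R V} m a x _ _.
Arguments msle_add {R V} m x y z _.
Arguments msle_scale {R V} m a x _ _.
Context {R : realType} {V : lmodType R} (M : mixed_lattice V).
Local Notation le := (mle M).
Local Notation sle := (msle M).
Local Notation "x ⋏ y" := (mlow M x y) (at level 45).
(* Unqualified, [mup] is the root multiplicity of polydiv. *)
Local Notation "x ⋎ y" := (Defs.mup M x y) (at level 45).
Local Notation s := (sabs M).

Local Notation leD := (compat_addD (mle_add M) _ _ _ _ (@mle_trans R V M)).
Local Notation sleD := (compat_addD (msle_add M) _ _ _ _ (@msle_trans R V M)).

Lemma mup_addr x y z : (x + z) ⋎ (y + z) = x ⋎ y + z.
Proof.
have h a b c : le ((a + c) ⋎ (b + c)) (a ⋎ b + c).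
  by apply: mup_min; [apply: msle_add; apply: mup_sle|apply: mle_add; apply: mup_le].
apply: mle_anti (h x y z) _.
(* The reverse inequality is [h] itself, applied to the translated pair and [- z]. *)
have := mle_add M _ _ z (h (x + z) (y + z) (- z)).
by rewrite !addrK subrK.
Qed.

(** Negation reverses both orders, hence exchanges the maximum with the minimum. *)
Lemma mlow_opp x y : x ⋏ y = - ((- x) ⋎ (- y)).
Proof.
have nle a b : le (- a) b -> le (- b) a.
  by move/(compat_opp (mle_add M)); rewrite opprK.
have nsle a b : sle (- a) b -> sle (- b) a.
  by move/(compat_opp (msle_add M)); rewrite opprK.
apply: mle_anti; last first.
  by apply: mlow_max; [apply/nsle/mup_sle|apply/nle/mup_le].
rewrite -[x ⋏ y]opprK; apply: (compat_opp (mle_add M)); apply: mup_min.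
  by apply: (compat_opp (msle_add M)); apply: mlow_sle.
by apply: (compat_opp (mle_add M)); apply: mlow_le.
Qed.

Lemma mup_x0 x : x ⋎ 0 = x + 0 ⋎ (- x).
Proof. by rewrite [RHS]addrC -mup_addr add0r addNr. Qed.

(** After [mup_x0] the terms [x] and [- x] cancel; each remaining summand occurs twice, which
    absorbs the factor 1/2. *)
Lemma sabs_mup0x x : s x = 0 ⋎ x + 0 ⋎ (- x).
Proof.
rewrite /sabs !mup_x0 opprK.
set a := 0 ⋎ x; set b := 0 ⋎ (- x).
have -> : x + b + b + (- x + a) + a = 2%:R *: (a + b).
  rewrite scaler_nat mulr2n -(addrA x b b) [x + _ + _]addrACA subrr add0r.
  by rewrite -[b + b + a + a]addrA addrC [RHS]addrACA.
by rewrite scalerA mulVf ?scale1r // pnatr_eq0.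
Qed.

Lemma sabs_mupx0 x : s x = x ⋎ 0 + (- x) ⋎ 0.
Proof.
by rewrite sabs_mup0x !mup_x0 opprK addrACA subrr add0r addrC.
Qed.

Lemma sabs_opp x : s (- x) = s x.
Proof. by rewrite !sabs_mup0x opprK addrC. Qed.

Lemma Vsp_sabs x : Vsp M (s x).
Proof.
rewrite sabs_mup0x /Vsp -[0 in X in sle X _](addr0 (0 : V)).
by apply: sleD; apply: mup_sle.
Qed.

Lemma mup_x0_le_sabs x : le (x ⋎ 0) (s x).
Proof.
by rewrite sabs_mupx0; apply: (compat_addDr (mle_add M)); apply: mup_le.
Qed.

Lemma sabs_add x y : le (s (x + y)) (s x + s y).
Proof.
(* The right side is specifically positive and dominates [u + v], so it bounds the minimum. *)
have h u v : le (0 ⋎ (u + v)) (0 ⋎ u + 0 ⋎ v).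
  apply: mup_min; last by apply: leD; apply: mup_le.
  by rewrite -[0 in X in sle X _](addr0 (0 : V)); apply: sleD; apply: mup_sle.
by rewrite !sabs_mup0x addrACA opprD; apply: leD.
Qed.

Lemma sabs_mem (A : V -> Prop) x : mixed_lattice_subspace M A -> A x -> A (s x).
Proof.
move=> [[A0 AD AZ] _ AU] Ax.
have AN : A (- x) by rewrite -scaleN1r; apply: AZ.
by rewrite sabs_mup0x; apply: AD; apply: AU.
Qed.

(** * Consequences of quasi-regularity *)

Section QuasiRegular.
Hypothesis Hq : quasi_regular M.

(* 0 ⋏ x lies in V_sp by quasi-regularity, and 0 ⋏ x ⪯ 0, so 0 = 0 ⋏ x <= x. *)
Lemma Vsp_ge0 x : Vsp M x -> le 0 x.
Proof.
move=> hx; have [h _] := Hq _ _ (msle_refl M 0) hx.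
by rewrite {1}(msle_anti h (mlow_sle M 0 x)); apply: mlow_le.
Qed.

Lemma sle_le x y : sle x y -> le x y.
Proof.
by move/(compat_sub_ge0 (msle_add M))/Vsp_ge0/(compat_sub_ge0 (mle_add M)).
Qed.

Lemma mup_x0_le x : le x (x ⋎ 0).
Proof. exact/sle_le/mup_sle. Qed.

Lemma sabs_ge x : le x (s x).
Proof. exact: mle_trans (mup_x0_le x) (mup_x0_le_sabs x). Qed.

(** Here [x] itself attains the minimum defining [0 ⋎ x], and [0] the one defining [0 ⋎ (- x)]. *)
Lemma sabs_Vsp x : Vsp M x -> s x = x.
Proof.
move=> hx; have x0 := Vsp_ge0 _ hx.
have h1 : 0 ⋎ x = x.
  by apply: mle_anti; [apply: mup_min => //; apply: mle_refl|apply: mup_le].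
have h2 : 0 ⋎ (- x) = 0.
  apply: mle_anti; last by apply/Vsp_ge0/mup_sle.
  apply: mup_min; first exact: msle_refl.
  by have := compat_opp (mle_add M) _ _ x0; rewrite oppr0.
by rewrite sabs_mup0x h1 h2 addr0.
Qed.

Lemma mup0x_le_sabs x : le (0 ⋎ x) (s x).
Proof.
by rewrite sabs_mup0x; apply: (compat_addDr (mle_add M)); apply/Vsp_ge0/mup_sle.
Qed.

(** The part [0 ⋎ y] is controlled by [z], and [0 ⋎ (- y)] by [- x]. This yields the order convexity
    of [D]. *)
Lemma sabs_interval x y z : le x y -> le y z -> le (s y) (s z + s x).
Proof.
have mono u v : le u v -> le (0 ⋎ u) (0 ⋎ v).
  move=> uv; apply: mup_min; first exact: mup_sle.
  exact: mle_trans uv (mup_le M 0 v).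
move=> xy yz; rewrite sabs_mup0x -(sabs_opp x); apply: leD.
  by apply: mle_trans (mup0x_le_sabs z); apply: mono.
apply: mle_trans (mup0x_le_sabs (- x)); apply: mono.
exact: (compat_opp (mle_add M)).
Qed.

Lemma mlow_eq0 z x : Vsp M z -> Vsp M x -> le (z ⋏ x) 0 -> z ⋏ x = 0.
Proof.
move=> hz hx h; apply: mle_anti h _; apply: Vsp_ge0.
by have [] := Hq _ _ hz hx.
Qed.

(** * The generating set [G] and the ideal [D] it determines *)

Section Disjoint.
Variable A : V -> Prop.
Hypothesis HA : mixed_lattice_subspace M A.
Local Notation G := (rdisj_gen M A).

Lemma rdisj_gen_solid x y : Vsp M y -> le y x -> G x -> G y.
Proof.
move=> hy yx [_ hx]; split=> // z Az hz; apply: mlow_eq0 => //.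
rewrite -(hx z Az hz); apply: mlow_max; first exact: mlow_sle.
exact: mle_trans (mlow_le M z y) yx.
Qed.

(* For w = z ⋏ (x + y) we have w - y ⪯ z and w - y <= x, hence w - y <= z ⋏ x = 0;
   then w ⪯ z and w <= y give w <= z ⋏ y = 0. *)
Lemma rdisj_gen_add x y : G x -> G y -> G (x + y).
Proof.
move=> [hx Gx] [hy Gy].
have hxy : Vsp M (x + y).
  exact: msle_trans hx (compat_addDr (msle_add M) x y hy).
split=> // z Az hz; apply: mlow_eq0 => //.
set w := z ⋏ (x + y).
have wy : le w y.
  have := mle_add M (w - y) 0 y; rewrite subrK add0r; apply.
  rewrite -(Gx z Az hz); apply: mlow_max.
    apply: msle_trans (mlow_sle M z (x + y)).
    apply/(compat_sub_ge0 (msle_add M)).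
    by rewrite opprB addrC subrK.
  have := mle_add M _ _ (- y) (mlow_le M z (x + y)).
  by rewrite addrK.
by rewrite -(Gy z Az hz); apply: mlow_max => //; apply: mlow_sle.
Qed.

Lemma rdisj_gen0 : G 0.
Proof.
split=> [|z _ hz]; first exact: msle_refl.
by apply: mlow_eq0 => //; [apply: msle_refl|apply: mlow_le].
Qed.

(** For [a > 0] the scalar moves to the other argument: [a^-1 *: z] stays in [A] and is specifically
    positive, so its lower envelope with [x] vanishes. *)
Lemma rdisj_gen_scale (a : R) x : 0 <= a -> G x -> G (a *: x).
Proof.
case: HA => [[_ _ AZ] _ _].
rewrite le_eqVlt => /predU1P[<- _|a0 [hx Gx]].
  by rewrite scale0r; apply: rdisj_gen0.
have hax : Vsp M (a *: x) by apply: msle_scale => //; apply: ltW.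
split=> // z Az hz; apply: mlow_eq0 => //.
have ai0 : 0 <= a^-1 by rewrite invr_ge0 ltW.
have hz' : Vsp M (a^-1 *: z) by apply: msle_scale.
have h : le (a^-1 *: (z ⋏ (a *: x))) 0.
  rewrite -(Gx _ (AZ a^-1 z Az) hz'); apply: mlow_max.
    apply: (compat_scale (msle_add M) _ _ _ (msle_scale M)) => //.
    exact: mlow_sle.
  have := compat_scale (mle_add M) _ _ _ (mle_scale M) ai0 (mlow_le M z (a *: x)).
  by rewrite scalerA mulVf ?scale1r // gt_eqF.
have := compat_scale (mle_add M) _ _ _ (mle_scale M) (ltW a0) h.
by rewrite scalerA mulfV ?scale1r ?scaler0 // gt_eqF.
Qed.

Local Notation D := (fun x => G (s x)).

Lemma sabs_scale_ge0 (a : R) x : 0 <= a -> le (s (a *: x)) (a *: s x).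
Proof.
move=> a0.
have h u : le (0 ⋎ (a *: u)) (a *: (0 ⋎ u)).
  apply: mup_min; first by apply: msle_scale => //; apply: mup_sle.
  by apply: (compat_scale (mle_add M) _ _ _ (mle_scale M)) => //; apply: mup_le.
by rewrite !sabs_mup0x -scalerN scalerDr; apply: leD.
Qed.

Lemma ideal_sabs_rdisj_gen : ideal M D.
Proof.
have D0 : D 0 by rewrite sabs_Vsp; [apply: rdisj_gen0|apply: msle_refl].
have DD x y : D x -> D y -> D (x + y).
  move=> hx hy; apply: rdisj_gen_solid (Vsp_sabs _) (sabs_add x y) _.
  exact: rdisj_gen_add.
have DN x : D x -> D (- x) by rewrite sabs_opp.
have DZ0 (a : R) x : 0 <= a -> D x -> D (a *: x).
  move=> a0 hx; apply: rdisj_gen_solid (Vsp_sabs _) (sabs_scale_ge0 a x a0) _.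
  exact: rdisj_gen_scale.
have DZ (a : R) x : D x -> D (a *: x).
  case: (lerP 0 a) => [|/ltW a0] hx; first exact: DZ0.
  by rewrite -[a]opprK scaleNr; apply: DN; apply: DZ0 => //; rewrite oppr_ge0.
have Dconv : order_convex M D.
  move=> x y z hx hz xy yz.
  apply: rdisj_gen_solid (Vsp_sabs _) (sabs_interval _ _ _ xy yz) _.
  exact: rdisj_gen_add.
(* The upper endpoint [s x] belongs to [D] because [s (s x) = s x]. *)
have Dup0 x : D x -> D (x ⋎ 0).
  move=> hx; apply: (Dconv 0 _ (s x)) => //; last exact: mup_x0_le_sabs.
    by rewrite sabs_Vsp //; apply: Vsp_sabs.
  exact: mup_le.
(* By translation, [x ⋎ y = (x - y) ⋎ 0 + y]. *)
have Dup x y : D x -> D y -> D (x ⋎ y).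
  move=> hx hy; rewrite -[x](subrK y) -[y in _ ⋎ y]add0r mup_addr.
  by apply: (DD) => //; apply: Dup0; apply: DD => //; apply: DN.
split=> //; split=> // x y hx hy.
by rewrite mlow_opp; apply: (DN); apply: Dup; apply: DN.
Qed.

Lemma right_disjoint_complement_sabs x : right_disjoint_complement M A x <-> D x.
Proof.
split=> [h|hx I [[[I0 ID IZ] _ _] Iconv] GI].
  (* [D] is one of the ideals being intersected: it contains [G] since [s] fixes the elements of
     [G]. *)
  by apply: h ideal_sabs_rdisj_gen _ => y hy; rewrite sabs_Vsp //; case: hy.
have Is := GI _ hx.
apply: (Iconv (- s x) x (s x)) => //; first by rewrite -scaleN1r; apply: IZ.
  have := compat_opp (mle_add M) _ _ (sabs_ge (- x)).
  by rewrite opprK sabs_opp.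
exact: sabs_ge.
Qed.

(** Each [s z] with [z] in [A] is a specifically positive element of [A], and each such element is
    its own [s], so both conditions test the same elements. *)
Lemma rdisj_gen_sabs x : D x <-> forall z, A z -> s z ⋏ s x = 0.
Proof.
split=> [[_ h] z Az|h]; first by apply: h; [apply: sabs_mem|apply: Vsp_sabs].
split=> [|z Az hz]; first exact: Vsp_sabs.
by rewrite -(h z Az) (sabs_Vsp z).
Qed.

End Disjoint.
End QuasiRegular.
End MixedLattice.

Theorem theorem5p19 (R : realType) (V : lmodType R) (M : mixed_lattice V)
  (Hq : quasi_regular M) (A : V -> Prop) (HA : mixed_lattice_subspace M A) :
  forall x : V,
    right_disjoint_complement M A x <->
    (forall z : V, A z -> mlow M (sabs M z) (sabs M x) = 0).
Proof.
move=> x; apply: iff_trans (rdisj_gen_sabs M Hq A HA x).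
exact: right_disjoint_complement_sabs.
Qed.
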